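(* Let $K$ and $L$ be $k$-dimensional cubical complexes. If there exists an embedding, or more generally a non-degenerate mapping (cubical immersion), $f:K\to L$, then \[ Z(K)\geq Z(L),\quad\text{or equivalently}\quad CC(K)\leq CC(L). \]
   Context: Here $k\ge 1$. A poset $P$ is cubical if (a) for each $x\in P$ the subposet $P_{\le x}$ is isomorphic to the face poset (of non-empty faces) of some cube $I^q$, and (b) whenever a pair $x,y\in P$ is bounded from above it has a least upper bound. A cubical complex $K$ is a regular CW-complex whose face poset $P_K$ is cubical. A map of cubical complexes $f:K\to L$ is non-degenerate (a cubical or combinatorial immersion) if it is given by a monotone map $f:P_K\to P_L$ which for each $x\in P_K$ restricts to an isomorphism of posets $(P_K)_{\le x}\to (P_L)_{\le f(x)}$; an embedding is an injective non-degenerate map. Groupoid and holonomy: for a $k$-dimensional cubical complex $K$, the groupoid $\mathcal{E}(K)$ has as objects the $k$-dimensional cubes of $K$, each cube $\sigma$ being identified with its face poset $(P_K)_{\le\sigma}$. If $\sigma_1,\sigma_2$ have a common $(k-1)$-dimensional face $\delta$, an elementary morphism from $\sigma_1$ to $\sigma_2$ is an isomorphism of face posets $\sigma_1\to\sigma_2$ which fixes $\delta$ and all its faces. A morphism from $\sigma$ to $\sigma'$ is an isomorphism of face posets which is a composition of elementary morphisms. The holonomy group is $\Pi(K,\sigma):=\mathcal{E}(K)(\sigma,\sigma)$, a subgroup of the symmetry group of the cube $\sigma$. $BC_k$ is the group of all symmetries of a $k$-cube, identified with the group of all signed permutation $(k\times k)$-matrices (linear parts acting on coordinate directions); $BC_k^{even}$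 is its (normal) subgroup of matrices with an even number of $(-1)$-entries. The symmetry group of $\sigma$ is identified with $BC_k$ via any isomorphism $\sigma\cong I^k$. Invariants: for a $k$-dimensional cubical complex $K$, $I(K)=0$ if $\Pi(K,\sigma)\subset BC_k^{even}$ for all $k$-cubes $\sigma$ of $K$, and $I(K)=1$ otherwise. Let $f_k(W)$ denote the number of $k$-dimensional cubes of $W$. Then \[ Z(K):=\inf\{f_k(W)\mid W\subset K \text{ a ($k$-dimensional) subcomplex with } I(W)=1\}, \] so that $Z(K)=+\infty$ if $I(K)=0$, and the combinatorial curvature is $CC(K):=1/Z(K)$, which is $0$ if $I(K)=0$. *)

(* Defs.v *)
From HB Require Import structures.
From mathcomp Require Import all_boot all_order all_algebra all_fingroup.
From mathcomp Require Import all_classical all_reals all_analysis.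

Set Implicit Arguments.
Unset Strict Implicit.
Unset Printing Implicit Defensive.

Import Order.TTheory GRing.Theory Num.Theory.
Import numFieldNormedType.Exports.

Local Open Scope classical_set_scope.
Local Open Scope ring_scope.

(** * Posets *)

HB.instance Definition _ d (P : porderType d) (p : pred P) :=
  [SubChoice_isSubPOrder of {x : P | p x} by <: with d].

Definition poset_iso d1 d2 (P : porderType d1) (Q : porderType d2)
    (f : P -> Q) : Prop :=
  bijective f /\ {mono f : x y / (x <= y)%O}.

Definition lower d (P : porderType d) (x : P) : set P := [set y | (y <= x)%O].

Definition is_lower_set d (P : porderType d) (W : set P) : Prop :=
  forall x y : P, W x -> (y <= x)%O -> W y.

(** * The cube *)

(* A non-empty face of [-1, 1]^q is a product of faces of [-1, 1]; in each
   coordinate, None stands for the whole interval and Some true (resp.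
   Some false) for the end point 1 (resp. -1). *)
Definition cube_face (q : nat) := {ffun 'I_q -> option bool}.

HB.instance Definition _ q := Finite.on (cube_face q).

Definition subface q (F G : cube_face q) : bool :=
  [forall i, (G i == None) || (F i == G i)].

Fact subface_refl q : reflexive (@subface q).
Proof. by move=> F; apply/forallP => i; rewrite eqxx orbT. Qed.

Fact subface_anti q : antisymmetric (@subface q).
Proof.
move=> F G /andP[/forallP FG /forallP GF]; apply/ffunP => i.
move: (FG i) (GF i) => /orP[/eqP G0|/eqP->//].
by rewrite G0 orbC => /orP[/eqP<-//|/eqP->].
Qed.

Fact subface_trans q : transitive (@subface q).
Proof.
move=> G F H /forallP FG /forallP GH; apply/forallP => i.
move: (GH i) => /orP[->//|/eqP<-]; exact: FG.
Qed.

Fact cube_display : Order.disp_t. Proof. exact: Order.Disp tt tt. Qed.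

HB.instance Definition _ q := Order.Le_isPOrder.Build cube_display (cube_face q)
  (@subface_refl q) (@subface_anti q) (@subface_trans q).

Definition barycenter q (F : cube_face q) : 'cV[int]_q :=
  \col_i (if F i is Some b then (if b then 1 else -1) else 0).

Definition BC k : set 'M[int]_k :=
  [set M | exists (e : 'I_k -> bool) (s : 'S_k),
     M = diag_mx (\row_i (-1) ^+ e i) *m perm_mx s].

Definition BCeven k : set 'M[int]_k :=
  [set M | BC M /\
     ~~ odd #|[set ij : 'I_k * 'I_k | M ij.1 ij.2 == -1]%SET| ].

(** * Cubical posets and their holonomy *)

Section cubical_posets.
Context {d : Order.disp_t}.
Implicit Types (P : porderType d) (k : nat).

Definition is_cube P k (x : P) : Prop :=
  exists f : lower x -> cube_face k, poset_iso f.

Definition cubical P : Prop :=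
  (forall x : P, exists q, is_cube q x) /\
  (forall x y : P, ubound [set x; y] !=set0 -> supremums [set x; y] !=set0).

Definition has_dim P k : Prop :=
  (forall (x : P) q, is_cube q x -> (q <= k)%N) /\ exists x : P, is_cube k x.

Definition elementary P k (s t : P) (phi : lower s -> lower t) : Prop :=
  [/\ is_cube k s, is_cube k t, poset_iso phi &
      exists delta : P, [/\ is_cube k.-1 delta, (delta <= s)%O, (delta <= t)%O &
        forall y : lower s, (val y <= delta)%O -> val (phi y) = val y]].

Inductive morphism P k : forall s t : P, (lower s -> lower t) -> Prop :=
| morphism_id s : is_cube k s -> morphism k (@id (lower s))
| morphism_comp s t u (phi : lower s -> lower t) (psi : lower t -> lower u) :
    elementary k phi -> morphism k psi -> morphism k (psi \o phi).

Definition holonomy P k (s : P) : set (lower s -> lower s) :=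
  [set phi | morphism k phi].
Arguments holonomy {P} k s.

(* A symmetry of the cube [-1, 1]^k is linear and is determined by its action
   on the barycenters of the faces. *)
Definition acts_as P k (s : P) (theta : lower s -> cube_face k)
    (phi : lower s -> lower s) (M : 'M[int]_k) : Prop :=
  forall y, barycenter (theta (phi y)) = M *m barycenter (theta y).

Definition even_holonomy P k : Prop :=
  forall s : P, is_cube k s ->
  forall theta : lower s -> cube_face k, poset_iso theta ->
  holonomy k s `<=` [set phi | exists2 M, BCeven M & acts_as theta phi M].

Definition Iinv P k : nat := if `[< even_holonomy P k >] then 0 else 1.

Definition fcount (R : realType) P k : \bar R :=
  counting [set x : P | is_cube k x].

(* In a regular CW complex the subcomplexes are the sets of cells closed under
   passing to faces; the face poset of W is the induced one. *)
Definition Zinv (R : realType) P k : \bar R :=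
  ereal_inf [set fcount R W k | W in
    [set W : set P | [/\ is_lower_set W, has_dim W k & Iinv W k = 1%N]]].

(* On \bar R, inversion sends +oo to 0. *)
Definition CC (R : realType) P k : \bar R := ((Zinv R P k)^-1)%E.

Definition non_degenerate (P Q : porderType d) (f : P -> Q) : Prop :=
  {homo f : x y / (x <= y)%O} /\
  forall x, exists2 g : lower x -> lower (f x),
    poset_iso g & forall y, val (g y) = f (val y).

End cubical_posets.

(** * Cubical complexes *)

Section disks.
Variables (R : realType) (n : nat).

Definition sqnorm (v : 'rV[R]_n) : R := \sum_i v ord0 i ^+ 2.
Definition disk : set 'rV[R]_n := [set v | sqnorm v <= 1].
Definition open_disk : set 'rV[R]_n := [set v | sqnorm v < 1].
Definition sphere : set 'rV[R]_n := [set v | sqnorm v = 1].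

End disks.
Arguments disk : clear implicits.
Arguments open_disk : clear implicits.
Arguments sphere : clear implicits.

Record regularCW (R : realType) := RegularCW {
  cw_space : topologicalType;
  cw_index : choiceType;
  cw_dim : cw_index -> nat;
  cw_char : forall c, 'rV[R]_(cw_dim c) -> cw_space;
  cw_cell := fun c => cw_char (c := c) @` open_disk R (cw_dim c);
  cw_closed_cell := fun c => cw_char (c := c) @` disk R (cw_dim c);
  cw_hausdorff : hausdorff_space cw_space;
  cw_cover : \bigcup_c cw_cell c = [set: cw_space];
  cw_disjoint : trivIset [set: cw_index] cw_cell;
  cw_regular : forall c, {within disk R (cw_dim c), continuous (cw_char (c := c))} /\
    exists psi : cw_space -> 'rV[R]_(cw_dim c),
      {in disk R (cw_dim c), cancel (cw_char (c := c)) psi} /\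
      {within cw_closed_cell c, continuous psi};
  cw_boundary : forall c, exists s : seq cw_index,
    {in s, forall e, (cw_dim e < cw_dim c)%N} /\
    cw_char (c := c) @` sphere R (cw_dim c) `<=` \bigcup_(e in [set` s]) cw_cell e;
  cw_weak : forall A : set cw_space,
    (forall c, closed (A `&` cw_closed_cell c)) -> closed A
}.

Definition face_poset (R : realType) (K : regularCW R) : Type := cw_index K.

Section face_poset.
Variables (R : realType) (K : regularCW R).

HB.instance Definition _ := Choice.on (face_poset K).

Definition is_face (c e : face_poset K) : bool :=
  `[< cw_closed_cell c `<=` cw_closed_cell e >].

Fact is_face_refl : reflexive is_face.
Proof. by move=> c; apply/asboolP. Qed.

Fact is_face_trans : transitive is_face.
Proof.
by move=> b a c /asboolP ab /asboolP bc; apply/asboolP; exact: subset_trans bc.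
Qed.

Let is_face_dim (c e : face_poset K) :
  is_face c e -> (cw_dim e <= cw_dim c)%N -> c = e.
Proof.
move=> /asboolP ce dim_ec.
have z0 : sqnorm (0 : 'rV[R]_(cw_dim c)) = 0.
  by rewrite /sqnorm big1// => i _; rewrite mxE expr0n.
have same a x : cw_cell c x -> cw_cell a x -> c = a.
  by move=> cx ax; apply: (@cw_disjoint R K c a) => //; exists x.
pose x := cw_char (c := c) 0.
have cx : cw_cell c x by exists 0 => //; rewrite /open_disk/= z0 ltr01.
have [v] : cw_closed_cell e x.
  by apply: ce; exists 0 => //; rewrite /disk/= z0 ler01.
rewrite /disk/= le_eqVlt => /orP[/eqP v1|v1] vx; last first.
  by apply: (same _ x) => //; exists v.
have [s [dims /(_ x)]] := cw_boundary e.
case; first by exists v.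
move=> a /= as_ /(same _ _ cx) ca; move: (dims a as_).
by rewrite -ca ltnNge dim_ec.
Qed.

Fact is_face_anti : antisymmetric is_face.
Proof.
move=> c e /andP[ce ec]; case: (leqP (cw_dim e) (cw_dim c)) => [|/ltnW] h.
  exact: is_face_dim.
by apply/esym; exact: is_face_dim.
Qed.

Fact face_display : Order.disp_t. Proof. exact: Order.Disp tt tt. Qed.

HB.instance Definition _ := Order.Le_isPOrder.Build face_display (face_poset K)
  is_face_refl is_face_anti is_face_trans.

End face_poset.

Record cubical_complex (R : realType) := CubicalComplex {
  cc_cw :> regularCW R;
  cc_cubical : cubical (face_poset cc_cw)
}.

(* Main.v *)
Require Import Defs.
From mathcomp Require Import all_boot all_order all_algebra.
From mathcomp Require Import all_classical all_reals all_analysis.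

(** A non-degenerate map identifies the faces of [s] with those of [f s], so
    conjugating by these identifications carries elementary morphisms, hence
    holonomies, of the source to those of the target: an odd holonomy of a
    subcomplex [W] gives an odd holonomy of [f W]. As [f W] has at most as many
    [k]-cubes as [W], every competitor for [Z(K)] is bounded below by one for
    [Z(L)]. *)

Set Implicit Arguments.
Unset Strict Implicit.
Unset Printing Implicit Defensive.

Import Order.TTheory Num.Theory.
Local Open Scope classical_set_scope.

Lemma poset_iso_comp d1 d2 d3 (A : porderType d1) (B : porderType d2)
    (C : porderType d3) (g : B -> C) (f : A -> B) :
  poset_iso g -> poset_iso f -> poset_iso (g \o f).
Proof.
move=> [bg mg] [bf mf]; split; first exact: bij_comp.
by move=> x y; rewrite /= mg mf.
Qed.

Lemma poset_iso_inv d1 d2 (A : porderType d1) (B : porderType d2)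
    (f : A -> B) : poset_iso f ->
  exists g, [/\ poset_iso g, cancel f g & cancel g f].
Proof.
move=> [[g fK gK] mf]; exists g; split=> //; split; first by exists f.
by move=> x y; rewrite -mf !gK.
Qed.

Section non_degenerate.
Context {d : Order.disp_t}.
Implicit Types P Q : porderType d.

Lemma mem_lower P (x y : P) : (y <= x)%O -> y \in lower x.
Proof. exact: mem_set. Qed.

Lemma lower_le P (x : P) (y : lower x) : (val y <= x)%O.
Proof. by have := set_mem (valP y). Qed.

(** A criterion in terms of [f] alone, free of subtypes: this form is easy to use on single faces
    and to check for restrictions of [f]. *)
Lemma non_degenerateP P Q (f : P -> Q) : non_degenerate f <->
  {homo f : x y / (x <= y)%O} /\
  forall x, (forall y z, (y <= x)%O -> (z <= x)%O ->
               (f y <= f z)%O -> (y <= z)%O) /\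
            (forall w, (w <= f x)%O -> exists2 y, (y <= x)%O & f y = w).
Proof.
split=> -[hf H]; split=> // x.
  have [g [[h gK hK] mg] gE] := H x; split=> [y z yx zx | w wx].
    have := mg (SigSub (mem_lower yx)) (SigSub (mem_lower zx)).
    by rewrite !leEsub !gE /= => ->.
  exists (val (h (SigSub (mem_lower wx)))); first exact: lower_le.
  by rewrite -gE hK.
have [Hle Hsurj] := H x.
have fP (y : lower x) : f (val y) \in lower (f x).
  by apply/mem_lower/hf/lower_le.
exists (fun y => SigSub (fP y)) => //.
have mono : {mono (fun y => SigSub (fP y) : lower (f x)) : y z / (y <= z)%O}.
  move=> y z; rewrite !leEsub /=; apply/idP/idP; last exact: hf.
  by apply: Hle; exact: lower_le.
split=> //.
have surj (w : lower (f x)) : exists y, SigSub (fP y) = w.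
  have [y yx yw] := Hsurj _ (lower_le w).
  by exists (SigSub (mem_lower yx)); apply/val_inj.
(* The inverse chooses preimages; order reflection and antisymmetry give injectivity, so it is also
   a left inverse. *)
exists (fun w => sval (cid (surj w))) => [y|w]; last by case: cid.
by apply: (inc_inj mono); case: cid.
Qed.

Section transfer.
Variables (P Q : porderType d) (f : P -> Q).
Hypothesis nd_f : non_degenerate f.

Lemma is_cube_non_degenerate k (x : P) : is_cube k (f x) <-> is_cube k x.
Proof.
have [g ig _] := nd_f.2 x; split=> -[h ih].
  by exists (h \o g); exact: poset_iso_comp.
have [g' [ig' _ _]] := poset_iso_inv ig.
by exists (h \o g'); exact: poset_iso_comp.
Qed.

(** The image [f delta] serves as the common face fixed by the conjugated map. *)
Lemma elementary_non_degenerate k (s t : P) (phi : lower s -> lower t)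
    (g : lower (f s) -> lower s) (h : lower t -> lower (f t)) :
  poset_iso g -> (forall y, f (val (g y)) = val y) ->
  poset_iso h -> (forall y, val (h y) = f (val y)) ->
  elementary k phi -> elementary k (h \o phi \o g).
Proof.
move=> ig gE ih hE [cs ct iphi [delta [cd ds dt fix_delta]]].
split; try exact/is_cube_non_degenerate.
  by apply: poset_iso_comp => //; exact: poset_iso_comp.
exists (f delta); split; first exact/is_cube_non_degenerate.
- exact: nd_f.1.
- exact: nd_f.1.
move=> y; rewrite -gE => yd; rewrite /= hE fix_delta//.
(* Both [val (g y)] and [delta] lie below [s], where [f] reflects the order, so [fix_delta] applies
   to [g y]. *)
have [le_f _] := ((non_degenerateP f).1 nd_f).2 s.
by apply: le_f => //; exact: lower_le.
Qed.

Lemma non_degenerate_local_iso (s : P) :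
  exists (h : lower s -> lower (f s)) (g : lower (f s) -> lower s),
    [/\ poset_iso h, poset_iso g, cancel h g,
        forall y, val (h y) = f (val y) & forall y, f (val (g y)) = val y].
Proof.
have [h ih hE] := nd_f.2 s; have [g [ig hK gK]] := poset_iso_inv ih.
by exists h, g; split=> // y; rewrite -hE gK.
Qed.

(** The identifications [g] and [h] at the two ends are left arbitrary so that the induction can
    pick its own at the intermediate cube. *)
Lemma morphism_non_degenerate k (s t : P) (phi : lower s -> lower t) :
  morphism k phi ->
  forall (g : lower (f s) -> lower s) (h : lower t -> lower (f t)),
  poset_iso g -> (forall y, f (val (g y)) = val y) ->
  poset_iso h -> (forall y, val (h y) = f (val y)) ->
  morphism k (h \o phi \o g).
Proof.
elim=> {s t phi} [s cs|s t u phi psi ephi _ IH] g h ig gE ih hE.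
  (* Here [g] and [h] are not assumed to be mutually inverse; their compatibility with [f] forces
     it. *)
  have -> : h \o id \o g = id.
    by apply/funext => y; apply/val_inj; rewrite /= hE gE.
  exact/morphism_id/is_cube_non_degenerate.
have [ht [gt [iht igt htK htE gtE]]] := non_degenerate_local_iso t.
(* Insert [gt \o ht], the identity of [lower t], between the two factors. *)
have -> : h \o (psi \o phi) \o g = (h \o psi \o gt) \o (ht \o phi \o g).
  by apply/funext => y; rewrite /= htK.
by apply: morphism_comp; [exact: elementary_non_degenerate | exact: IH].
Qed.

Lemma even_holonomy_non_degenerate k : even_holonomy Q k -> even_holonomy P k.
Proof.
move=> evQ s cs theta itheta phi mphi.
have [h [g [ih ig hK hE gE]]] := non_degenerate_local_iso s.
have cfs : is_cube k (f s) by exact/is_cube_non_degenerate.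
(* In the frame [theta \o g] of [f s], the conjugate [h \o phi \o g] has the same matrix as [phi] in
   the frame [theta]. *)
have itg : poset_iso (theta \o g) by exact: poset_iso_comp.
have mhg : morphism k (h \o phi \o g) by exact: morphism_non_degenerate.
have [M evM actM] := evQ _ cfs _ itg _ mhg.
by exists M => // y; have := actM (h y); rewrite /= !hK.
Qed.

Section image.
Variable W : set P.
Hypothesis lowW : is_lower_set W.

Fact image_restrict_subproof (x : W) : f (val x) \in f @` W.
Proof. by apply/mem_set; exists (val x) => //; exact: set_mem (valP x). Qed.

Definition image_restrict (x : W) : (f @` W : Type) :=
  SigSub (image_restrict_subproof x).

Lemma image_restrict_surj (y : f @` W) : exists x, image_restrict x = y.
Proof.
have [x Wx xy] := set_mem (valP y).
by exists (SigSub (mem_set Wx)); apply/val_inj.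
Qed.

Lemma is_lower_set_image : is_lower_set (f @` W).
Proof.
move=> _ y [x Wx <-] yx.
have [z zx <-] := (((non_degenerateP f).1 nd_f).2 x).2 y yx.
by exists z => //; exact: lowW zx.
Qed.

Lemma image_restrict_non_degenerate : non_degenerate image_restrict.
Proof.
have [hf H] := (non_degenerateP f).1 nd_f.
apply/non_degenerateP; split=> [x y|x]; first by rewrite !leEsub; exact: hf.
have [inj_x surj_x] := H (val x); split=> [y z|w].
  by rewrite !leEsub; exact: inj_x.
rewrite leEsub => /surj_x[y yx yw].
(* The lift [y] is a face of a cell of [W], hence stays in [W]. *)
have Wy : W y by apply: lowW yx; exact: set_mem (valP x).
by exists (SigSub (mem_set Wy)); [rewrite leEsub | apply/val_inj].
Qed.

End image.
End transfer.

(** By surjectivity every cube of [Q] comes from a cube of [P] of the same dimension, which bounds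
    its dimension. *)
Lemma has_dim_surj P Q (f : P -> Q) k : non_degenerate f ->
  (forall y, exists x, f x = y) -> has_dim P k -> has_dim Q k.
Proof.
move=> nd surj [dimP [x cx]]; split; last first.
  by exists (f x); apply/is_cube_non_degenerate.
move=> y q; have [z <-] := surj y.
by move=> /(is_cube_non_degenerate nd); exact: dimP.
Qed.

Lemma counting_image_le (R : realType) (T U : choiceType) (f : T -> U)
    (A : set T) (B : set U) :
  B `<=` f @` A -> (counting B <= counting A :> \bar R)%E.
Proof.
move=> BfA; rewrite /counting; case: asboolP => [finB|infB]; last first.
  case: asboolP => [finA|_]; last by rewrite lexx.
  by case: infB; apply: sub_finite_set BfA _; exact: finite_image.
case: asboolP => [finA|_]; last by rewrite leey.
rewrite lee_fin ler_nat.
have finfA : finite_set (f @` A) by exact: finite_image.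
apply: (leq_trans (n := size (finmap.enum_fset (fset_set (f @` A))))).
  by apply: finmap.fsubset_leq_card; rewrite -fset_set_sub.
by rewrite fset_set_image//; exact: finmap.leq_imfset_card.
Qed.

Lemma fcount_surj_le (R : realType) P Q (f : P -> Q) k : non_degenerate f ->
  (forall y, exists x, f x = y) -> (fcount R Q k <= fcount R P k)%E.
Proof.
move=> nd surj; apply: (counting_image_le _ (f := f)) => y cy.
have [x xy] := surj y; exists x => //.
by apply/(is_cube_non_degenerate nd); rewrite xy.
Qed.

(** Needed to pass from [Zinv] to [CC]: inversion reverses the order only among elements of the same
    sign. *)
Lemma Zinv_ge0 (R : realType) P k : (0 <= Zinv R P k)%E.
Proof.
apply: le_ereal_inf_tmp => _ [W _ <-].
by rewrite /fcount /counting; case: ifP => // _; rewrite lee_fin ler0n.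
Qed.

Lemma Iinv_eq1 P k : Iinv P k = 1%N <-> ~ even_holonomy P k.
Proof. by rewrite /Iinv; case: asboolP. Qed.

Lemma Zinv_non_degenerate_le (R : realType) P Q (f : P -> Q) k :
  non_degenerate f -> (Zinv R Q k <= Zinv R P k)%E.
Proof.
move=> nd; apply: le_ereal_inf_tmp => _ [W [lowW dimW oddW] <-].
have ndW := image_restrict_non_degenerate nd lowW.
have surjW := @image_restrict_surj _ _ f W.
apply: le_trans (fcount_surj_le R k ndW surjW).
apply: ereal_inf_lbound; exists (f @` W) => //; split.
- exact: is_lower_set_image.
- exact: has_dim_surj ndW surjW dimW.
- apply/Iinv_eq1 => /(even_holonomy_non_degenerate ndW); exact/Iinv_eq1.
Qed.

End non_degenerate.

Theorem theorem3p7 (R : realType) (k : nat) (K L : cubical_complex R)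
    (f : face_poset K -> face_poset L) :
  (0 < k)%N ->
  has_dim (face_poset K) k -> has_dim (face_poset L) k ->
  non_degenerate f ->
  (Zinv R (face_poset L) k <= Zinv R (face_poset K) k)%E /\
  (CC R (face_poset K) k <= CC R (face_poset L) k)%E.
Proof.
move=> _ _ _ nd; have ZLK := Zinv_non_degenerate_le R k nd; split=> //.
by rewrite /CC lee_pV2// inE Zinv_ge0.
Qed.
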